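(* Let $\circledast$ be either the inclusion atom $\subseteq$ or the exclusion atom $\mid$. Then (i) $\mathcal{QPL}(\circledast_2)_n\not\le\mathcal{QPL}(\circledast_1)_m$ for all $n,m$ such that $0<n\le m\le 3n$; (ii) $\mathcal{QPL}(\circledast_{k+1})_n\not\le\mathcal{QPL}(\circledast_k)_m$ for all $k\ge 2$ and all $n,m$ such that $0<n\le m\le 2n$.
   Context: Let $\mathrm{Prop}$ be a countably infinite set of propositional symbols. Formulas of quantified propositional logic $\mathcal{QPL}$: $\phi::=p\mid\neg p\mid(\phi\wedge\phi)\mid(\phi\vee\phi)\mid\exists p\,\phi\mid\forall p\,\phi$ with $p\in\mathrm{Prop}$. $\mathrm{FV}(\phi)$ is the set of free propositional symbols. A team $T$ over a finite set of symbols $V=\mathrm{Var}(T)$ is a set of evaluations $s:V\to\{0,1\}$. For $\bar p=p_1\dots p_k$, $s(\bar p)=s(p_1)\dots s(p_k)$. $s(a/p)$ maps $p$ to $a$ and agrees with $s$ elsewhere. Semantics: $T\models p$ iff $s(p)=1$ for all $s\in T$; $T\models\neg p$ iff $s(p)=0$ for all $s\in T$; $T\models\phi\wedge\psi$ iff $T\models\phi$ and $T\models\psi$; $T\models\phi\vee\psi$ iff there are $S,S'\subseteq T$ with $S\cup S'=T$, $S\models\phi$, $S'\models\psi$; $T\models\exists p\,\phi$ iff there is $F:T\to\{\{0\},\{1\},\{0,1\}\}$ with $\{s(a/p)\mid s\in T,a\in F(s)\}\models\phi$; $T\models\forall p\,\phi$ iff $\{s(a/p)\mid s\in T,a\in\{0,1\}\}\models\phi$.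 For sequences $\bar p,\bar q$ of propositional symbols of equal length (the arity of the atom): $T\models\bar p\subseteq\bar q$ iff for all $s\in T$ there is $s'\in T$ with $s(\bar p)=s'(\bar q)$; $T\models\bar p\mid\bar q$ iff $s(\bar p)\neq s'(\bar q)$ for all $s,s'\in T$. $\mathcal{QPL}(\circledast_k)_n$ is the set of formulas of the extension of $\mathcal{QPL}$ by (unnegated) $\circledast$-atoms containing at most $n$ occurrences of $\circledast$-atoms, each of arity at most $k$. $\phi\equiv\psi$ means $\mathrm{FV}(\phi)=\mathrm{FV}(\psi)$ and $T\models\phi\iff T\models\psi$ for every team $T$ with $\mathrm{FV}(\phi)\subseteq\mathrm{Var}(T)$. $\mathcal L_1\le\mathcal L_2$ means every $\phi\in\mathcal L_1$ has some $\psi\in\mathcal L_2$ with $\phi\equiv\psi$. *)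

(* Defs.v *)
From mathcomp Require Import all_boot finmap.

Set Implicit Arguments.
Unset Strict Implicit.
Unset Printing Implicit Defensive.

Local Open Scope fset_scope.
Local Open Scope fmap_scope.

Inductive atom_kind := Inclusion | Exclusion.

(* Propositional symbols are natural numbers. [formula at_] is the extension of
   quantified propositional logic by the atoms of kind [at_]. *)
Inductive formula (at_ : atom_kind) : Type :=
| Pos (p : nat)
| Neg (p : nat)
| Atom (k : nat) (ps qs : k.-tuple nat)
| And (phi psi : formula at_)
| Or (phi psi : formula at_)
| Exists (p : nat) (phi : formula at_)
| Forall (p : nat) (phi : formula at_).

Fixpoint FV (at_ : atom_kind) (phi : formula at_) : {fset nat} :=
  match phi with
  | Pos p => [fset p]
  | Neg p => [fset p]
  | Atom _ ps qs => [fset p in tval ps ++ tval qs]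
  | And phi psi => FV phi `|` FV psi
  | Or phi psi => FV phi `|` FV psi
  | Exists p phi => FV phi `\ p
  | Forall p phi => FV phi `\ p
  end.

(* The arities of the atoms of a formula, one entry per occurrence. *)
Fixpoint arities (at_ : atom_kind) (phi : formula at_) : seq nat :=
  match phi with
  | Pos _ => [::]
  | Neg _ => [::]
  | Atom k _ _ => [:: k]
  | And phi psi => arities phi ++ arities psi
  | Or phi psi => arities phi ++ arities psi
  | Exists _ phi => arities phi
  | Forall _ phi => arities phi
  end.

(* An evaluation s : V -> {0,1} is a finite map with domain V; s(a/p) is the
   finite-map update [s.[p <- a]], whose domain is V together with p. *)
Definition evaluation := {fmap nat -> bool}.

(* A set of evaluations is finite as soon as they share a finite domain. The
   domain is a separate argument because the empty set is a team over every V. *)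
Definition team_over (V : {fset nat}) (T : {fset evaluation}) : Prop :=
  forall s, s \in T -> domf s = V.

(* s(p_1)...s(p_k); the entries are [Some] of a bit on symbols in the domain. *)
Definition values (s : evaluation) (ps : seq nat) : seq (option bool) :=
  [seq s.[? p] | p <- ps].

Definition sat_atom (at_ : atom_kind) (T : {fset evaluation})
    (ps qs : seq nat) : Prop :=
  match at_ with
  | Inclusion =>
      forall s, s \in T -> exists2 s', s' \in T & values s ps = values s' qs
  | Exclusion =>
      forall s s', s \in T -> s' \in T -> values s ps <> values s' qs
  end.

Fixpoint sat (at_ : atom_kind) (T : {fset evaluation}) (phi : formula at_) :
    Prop :=
  match phi with
  | Pos p => forall s, s \in T -> s.[? p] = Some true
  | Neg p => forall s, s \in T -> s.[? p] = Some false
  | Atom _ ps qs => sat_atom at_ T ps qs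
  | And phi psi => sat T phi /\ sat T psi
  | Or phi psi =>
      exists S S' : {fset evaluation},
        [/\ S `<=` T, S' `<=` T, S `|` S' = T, sat S phi & sat S' psi]
  | Exists p phi =>
      exists F : evaluation -> {fset bool},
        (forall s, s \in T -> F s != fset0) /\
        sat [fset s.[p <- a] | s in T, a in F s] phi
  | Forall p phi =>
      sat [fset s.[p <- a] | s in T, a in [fset false; true]] phi
  end.

Definition QPL (at_ : atom_kind) (k n : nat) (phi : formula at_) : Prop :=
  size (arities phi) <= n /\ (forall i, i \in arities phi -> i <= k).

Definition equivalent (at_ : atom_kind) (phi psi : formula at_) : Prop :=
  FV phi = FV psi /\
  (forall (V : {fset nat}) (T : {fset evaluation}),
     team_over V T -> FV phi `<=` V -> (sat T phi <-> sat T psi)).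

Definition le_logic (at_ : atom_kind) (L1 L2 : formula at_ -> Prop) : Prop :=
  forall phi, L1 phi -> exists2 psi, L2 psi & equivalent phi psi.

(* Main.v *)
Require Import Defs.
From mathcomp Require Import all_boot finmap zify.

(* Call a family of teams union-convex if it is closed under unions and convex
   for inclusion. A k-ary atom holds on the union of [dim k] union-convex
   families: an exclusion atom fixes a proper nonempty set A of k-bit words with
   p in A and q not in A; an inclusion atom fixes a set A, not a singleton, with
   p[T] <= A <= q[T], where the singletons are all replaced by one family,
   p = q pointwise. Conjunction, disjunction and the quantifiers send
   union-convex families to union-convex families, so a formula with m atoms of
   arity k needs at most [dim k ^ m] of them. Conversely, a conjunction of n
   atoms of arity K over disjoint symbols is satisfied by [dim K ^ n] product
   teams, and between one of any two of them and their union lies a team that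
   violates it; hence no two lie in the same family, and
   [dim K ^ n <= dim k ^ m] for any equivalent formula. *)

Set Implicit Arguments.
Unset Strict Implicit.
Unset Printing Implicit Defensive.

Local Open Scope fset_scope.
Local Open Scope fmap_scope.

(** * Counting the families of an atom *)

Definition dim (at_ : atom_kind) (k : nat) : nat :=
  match at_ with
  | Inclusion => 2 ^ 2 ^ k - 2 ^ k
  | Exclusion => 2 ^ 2 ^ k - 2
  end.

(* The empty set indexes the singletons all at once. *)
Definition index_set (at_ : atom_kind) (U : finType) : {set {set U}} :=
  match at_ with
  | Inclusion => [set A : {set U} | #|A| != 1]
  | Exclusion => [set A : {set U} | (A != set0) && (A != [set: U])]
  end.

Lemma card_index_set (at_ : atom_kind) (U : finType) (k : nat) :
  0 < k -> #|U| = 2 ^ k -> #|index_set at_ U| = dim at_ k.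
Proof.
move=> k_gt0 cardU.
have cardsetU : #|{set U}| = 2 ^ 2 ^ k.
  by rewrite -cardsT -powersetT card_powerset cardsT cardU.
(* The complement is counted: the singletons for inclusion, the two trivial sets for exclusion. *)
rewrite cardsCs cardsetU; case: at_; congr (_ - _).
  rewrite -cardU -[RHS]bin1 -card_draws; apply: eq_card => A.
  by rewrite !inE negbK.
have -> : 2 = #|[set set0; [set: U]]|.
  rewrite cards2; suff -> : set0 != [set: U] by [].
  by rewrite eq_sym -card_gt0 cardsT cardU expn_gt0.
by apply: eq_card => A; rewrite !inE negb_and !negbK.
Qed.

(** * Atoms as unions of pieces *)

(** Arbitrary maps [f] and [g] stand for the two words, so that one notion serves evaluations in
    teams and points of boxes. *)
Definition atomic (at_ : atom_kind) (E U : Type) (T : E -> Prop)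
    (f g : E -> U) : Prop :=
  match at_ with
  | Inclusion => forall s, T s -> exists2 s', T s' & f s = g s'
  | Exclusion => forall s s', T s -> T s' -> f s <> g s'
  end.

Definition piece (at_ : atom_kind) (E : Type) (U : finType) (A : {set U})
    (T : E -> Prop) (f g : E -> U) : Prop :=
  match at_ with
  | Inclusion =>
      if A == set0 then forall s, T s -> f s = g s
      else (forall s, T s -> f s \in A) /\
           (forall a, a \in A -> exists2 s, T s & g s = a)
  | Exclusion => forall s, T s -> (f s \in A) && (g s \notin A)
  end.

Lemma piece_atomic (at_ : atom_kind) (E : Type) (U : finType) (A : {set U})
    (T : E -> Prop) (f g : E -> U) :
  piece at_ A T f g -> atomic at_ T f g.
Proof.
case: at_ => /=.
  case: eqP => _ => [fg|[fA Ag]] s Ts; first by exists s; rewrite ?fg.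
  by have [s' Ts' eq_g] := Ag _ (fA s Ts); exists s'.
move=> TA s s' Ts Ts' eq_fg.
by have [/andP[fA _] /andP[_]] := (TA _ Ts, TA _ Ts'); rewrite -eq_fg fA.
Qed.

(** The natural choice of [A] is the image of [g] for inclusion and the image of [f] for
    exclusion. *)
Lemma atomic_piece (at_ : atom_kind) (E : choiceType) (U : finType)
    (T : {fset E}) (f g : E -> U) :
  1 < #|U| -> atomic at_ (fun s => s \in T) f g ->
  exists2 A : {set U},
    A \in index_set at_ U & piece at_ A (fun s => s \in T) f g.
Proof.
move=> U_gt1.
case: at_ => /= incl.
  pose A := [set a | [exists s : T, g (val s) == a]].
  have fA s : s \in T -> f s \in A.
    move=> Ts; have [s' Ts' eq_fg] := incl s Ts.
    by rewrite inE; apply/existsP; exists [` Ts'] => /=; rewrite eq_fg.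
  have Ag a : a \in A -> exists2 s, s \in T & g s = a.
    by rewrite inE => /existsP[s /eqP <-]; exists (val s); first exact: valP.
  have gA s : s \in T -> g s \in A.
    by move=> Ts; rewrite inE; apply/existsP; exists [` Ts] => /=.
  (* If [g] has a single value, [f] takes that value too, and the diagonal family applies. *)
  have [/eqP/cards1P[a A1]|A1] := eqVneq #|A| 1.
    exists set0; first by rewrite inE cards0.
    rewrite eqxx => s Ts; have := fA s Ts; have := gA s Ts.
    by rewrite A1 !inE => /eqP-> /eqP->.
  exists A; first by rewrite inE.
  by case: eqP => // A0 s /fA; rewrite A0 inE.
pose A := [set a | [exists s : T, f (val s) == a]].
have fA s : s \in T -> f s \in A.
  by move=> Ts; rewrite inE; apply/existsP; exists [` Ts] => /=.
have gA s : s \in T -> g s \notin A.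
  move=> Ts; apply/negP; rewrite inE => /existsP[s' /eqP].
  by apply: incl => //; apply: valP.
(* The empty team has an empty image, which is no index; a singleton replaces it, proper because [U]
   has two elements. *)
have [T0|[s Ts]] := fset_0Vmem T.
  have [x _] : exists x : U, x \in U by apply/card_gt0P; apply: ltnW.
  exists [set x]; last by move=> s; rewrite T0 inE.
  rewrite inE; apply/andP; split; first by apply/set0Pn; exists x; rewrite inE.
  by apply: contraTneq U_gt1 => Ux; rewrite -cardsT -Ux cards1.
exists A; last by move=> s' Ts'; rewrite fA ?gA.
rewrite inE; apply/andP; split; first by apply/set0Pn; exists (f s); apply: fA.
by apply: contraNneq (gA s Ts) => ->; rewrite inE.
Qed.

(** * Union-convex families *)

(* Closure under binary unions ([T = T1 `|` T2]) and convexity ([T2] above [T])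
   in a single condition, which every connective preserves. *)
Definition union_convex (P : {fset evaluation} -> Prop) : Prop :=
  forall T1 T2 T, P T1 -> P T2 -> T1 `<=` T -> T `<=` T1 `|` T2 -> P T.

(** Universal conditions pass from [T1] and [T2] to any part of their union; existential ones pass
    from [T1] up to [T]. *)
Lemma piece_union_convex (at_ : atom_kind) (U : finType) (A : {set U})
    (f g : evaluation -> U) :
  union_convex (fun T => piece at_ A (fun s => s \in T) f g).
Proof.
move=> T1 T2 T + + /fsubsetP sT1 /fsubsetP sT.
have T12 s : s \in T -> s \in T1 \/ s \in T2.
  by move/sT; rewrite inE => /orP.
case: at_ => /=; last by move=> P1 P2 s /T12[/P1|/P2].
case: eqP => _; first by move=> P1 P2 s /T12[/P1|/P2].
move=> [f1 g1] [f2 g2]; split=> [s /T12[/f1|/f2] //|a /g1[s Ts <-]].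
by exists s; first exact: sT1.
Qed.

(** * Updates and padded words *)

(** No common domain is fixed, since an update at a quantified symbol may enlarge it. *)
Definition on_FV (at_ : atom_kind) (phi : formula at_) (T : {fset evaluation})
  : Prop := forall s, s \in T -> FV phi `<=` domf s.

Definition update (T : {fset evaluation}) (p : nat)
    (F : evaluation -> {fset bool}) : {fset evaluation} :=
  [fset s.[p <- a] | s in T, a in F s].

Lemma updateP (T : {fset evaluation}) (p : nat)
    (F : evaluation -> {fset bool}) (u : evaluation) :
  reflect (exists s a, [/\ s \in T, a \in F s & u = s.[p <- a]])
          (u \in update T p F).
Proof.
apply: (iffP (imfset2P _ _ _ _ _)) => [[s Ts [a Fa ->]]|[s [a [Ts Fa ->]]]].
  by exists s, a.
by exists s => //; exists a.
Qed.

Lemma on_FV_update (at_ : atom_kind) (phi : formula at_) (T : {fset evaluation})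
    (p : nat) (F : evaluation -> {fset bool}) :
  (forall s, s \in T -> FV phi `\ p `<=` domf s) -> on_FV phi (update T p F).
Proof.
move=> FVT u /updateP[s [a [Ts _ ->]]].
apply/fsubsetP=> x FVx; rewrite dom_setf !inE; case: eqP => //= /eqP xp.
by apply: (fsubsetP (FVT s Ts)); rewrite !inE xp.
Qed.

(* Padding with [true] reduces atoms of arity below [k], including 0, to arity
   [k]. *)
Definition pad (k : nat) (ps : seq nat) (s : evaluation) : {ffun 'I_k -> bool} :=
  [ffun j : 'I_k => nth true [seq s.[? p] == Some true | p <- ps] j].

(** On symbols of the domain every value is [Some] of a bit, so testing against [Some true] loses
    nothing. *)
Lemma pad_inj (k i : nat) (ps qs : i.-tuple nat) (s s' : evaluation) :
  i <= k -> {subset ps <= domf s} -> {subset qs <= domf s'} ->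
  pad k ps s = pad k qs s' <-> values s ps = values s' qs.
Proof.
move=> le_ik sps sqs; split=> [/ffunP eq_pad|eq_v]; last first.
  have eqb (u : evaluation) (rs : seq nat) :
      [seq u.[? p] == Some true | p <- rs] =
      [seq v == Some true | v <- values u rs] by rewrite -map_comp.
  by apply/ffunP=> j; rewrite !ffunE !eqb eq_v.
apply: (@eq_from_nth _ None); first by rewrite !size_map !size_tuple.
move=> j; rewrite size_map size_tuple => lt_ji.
have := eq_pad (Ordinal (leq_trans lt_ji le_ik)); rewrite !ffunE /=.
rewrite !(nth_map 0) ?size_tuple //.
have /sps p_s : nth 0 ps j \in ps by rewrite mem_nth ?size_tuple.
have /sqs q_s : nth 0 qs j \in qs by rewrite mem_nth ?size_tuple.
by rewrite (in_fnd p_s) (in_fnd q_s); do 2!case: (_.[_]).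
Qed.

Lemma sat_atomP (at_ : atom_kind) (U : Type) (T : {fset evaluation})
    (ps qs : seq nat) (f g : evaluation -> U) :
  (forall s s', s \in T -> s' \in T ->
     f s = g s' <-> values s ps = values s' qs) ->
  sat_atom at_ T ps qs <-> atomic at_ (fun s => s \in T) f g.
Proof.
move=> fgE; case: at_ => /=; split.
- move=> h s Ts; have [s' Ts' e] := h s Ts; exists s' => //; exact/fgE.
- move=> h s Ts; have [s' Ts' e] := h s Ts; exists s' => //; exact/fgE.
- by move=> h s s' Ts Ts' e; apply: (h s s') => //; apply/fgE.
- by move=> h s s' Ts Ts' e; apply: (h s s') => //; apply/fgE.
Qed.

(** * Covers, connective by connective *)

(** The equivalence matters in both directions: a satisfying team gets an index, and any team in a
    family satisfies the formula. *)
Definition covered (at_ : atom_kind) (phi : formula at_) (N : nat) : Prop :=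
  exists (I : finType) (P : I -> {fset evaluation} -> Prop),
    [/\ #|I| <= N, forall i, union_convex (P i) &
        forall T, on_FV phi T -> sat T phi <-> exists i, P i T].

Lemma covered_atom (at_ : atom_kind) (k i : nat) (ps qs : i.-tuple nat) :
  0 < k -> i <= k -> covered (Atom at_ ps qs) (dim at_ k).
Proof.
move=> k_gt0 le_ik.
pose U : finType := {ffun 'I_k -> bool}.
have cardU : #|U| = 2 ^ k by rewrite card_ffun card_bool card_ord.
exists {A : {set U} | A \in index_set at_ U}.
exists (fun A T => piece at_ (val A) (fun s => s \in T) (pad k ps) (pad k qs)).
split=> [|A|T FVT]; first by rewrite card_sig -(card_index_set at_ k_gt0 cardU).
  exact: piece_union_convex.
have sub s : s \in T -> {subset ps <= domf s} /\ {subset qs <= domf s}.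
  move/FVT/fsubsetP=> sub; split=> x x_p; apply: sub;
  by rewrite /= !inE x_p ?orbT.
apply: iff_trans (@sat_atomP at_ _ T ps qs (pad k ps) (pad k qs) _) _.
  by move=> s s' /sub[sps _] /sub[_ sqs]; apply: pad_inj.
split=> [|[A]]; last exact: piece_atomic.
case/(@atomic_piece _ _ U)=> [|A IA PA]; first by rewrite cardU -[1]/(2 ^ 0) ltn_exp2l.
by exists (exist _ A IA).
Qed.

Lemma covered_sub (at_ : atom_kind) (phi : formula at_) (N N' : nat) :
  N <= N' -> covered phi N -> covered phi N'.
Proof.
move=> leN [I [P [cardI cP satP]]]; exists I, P; split=> //.
exact: leq_trans leN.
Qed.

Lemma covered_literal (at_ : atom_kind) (p : nat) (a : bool) :
  covered (if a then Pos at_ p else Neg at_ p) 1.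
Proof.
exists unit, (fun _ (T : {fset evaluation}) => forall s, s \in T -> s.[? p] = Some a).
split=> [|_ T1 T2 T P1 P2 _ /fsubsetP sT s /sT|T _]; first by rewrite card_unit.
  by rewrite inE => /orP[/P1|/P2].
by case: a; split=> [|[]]; first exists tt.
Qed.

Lemma covered_And (at_ : atom_kind) (phi psi : formula at_) (N M : nat) :
  covered phi N -> covered psi M -> covered (And phi psi) (N * M).
Proof.
move=> [I [P [cardI cP satP]]] [J [Q [cardJ cQ satQ]]].
exists (I * J)%type, (fun ij T => P ij.1 T /\ Q ij.2 T).
split=> [|[i j] T1 T2 T [P1 Q1] [P2 Q2] s1 s2|T FVT].
- by rewrite card_prod leq_mul.
- by split; [apply: cP s1 s2|apply: cQ s1 s2].
have FVphi : on_FV phi T by move=> s /FVT; rewrite fsubUset => /andP[].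
have FVpsi : on_FV psi T by move=> s /FVT; rewrite fsubUset => /andP[].
split=> [[/(satP _ FVphi)[i Pi] /(satQ _ FVpsi)[j Qj]]|[[i j] [Pi Qj]]].
  by exists (i, j).
by split; [apply/(satP _ FVphi); exists i|apply/(satQ _ FVpsi); exists j].
Qed.

Lemma covered_Or (at_ : atom_kind) (phi psi : formula at_) (N M : nat) :
  covered phi N -> covered psi M -> covered (Or phi psi) (N * M).
Proof.
move=> [I [P [cardI cP satP]]] [J [Q [cardJ cQ satQ]]].
exists (I * J)%type, (fun ij T =>
  exists S S', [/\ S `|` S' = T, P ij.1 S & Q ij.2 S']).
split=> [|[i j] _ _ T [S1 [S1' [<- P1 Q1]]] [S2 [S2' [<- P2 Q2]]] s1 s2|T FVT].
- by rewrite card_prod leq_mul.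
(* Each half is the union of the two given halves cut down to [T]; it still contains the half from
   the first split. *)
- exists (T `&` (S1 `|` S2)), (T `&` (S1' `|` S2')); split.
  + by rewrite -fsetIUr; apply/fsetIidPl; rewrite fsetUACA.
  + apply: (cP _ S1 S2) => //; last exact: fsubsetIr.
    by rewrite fsubsetI fsubsetUl (fsubset_trans _ s1) ?fsubsetUl.
  + apply: (cQ _ S1' S2') => //; last exact: fsubsetIr.
    by rewrite fsubsetI fsubsetUl (fsubset_trans _ s1) ?fsubsetUr.
have FVS S S' : S `|` S' = T -> on_FV phi S /\ on_FV psi S'.
  by move=> eT; split=> s Ss; have := FVT s;
     rewrite -eT inE Ss ?orbT => /(_ isT); rewrite fsubUset => /andP[].
split=> [[S [S' [_ _ eT satS satS']]]|[[i j] [S [S' [eT Pi Qj]]]]];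
  have [FV1 FV2] := FVS _ _ eT.
  have [i Pi] := iffLR (satP _ FV1) satS.
  have [j Qj] := iffLR (satQ _ FV2) satS'.
  by exists (i, j), S, S'.
exists S, S'; rewrite -eT fsubsetUl fsubsetUr; split=> //.
  by apply/(satP _ FV1); exists i.
by apply/(satQ _ FV2); exists j.
Qed.

Lemma covered_Exists (at_ : atom_kind) (p : nat) (phi : formula at_) (N : nat) :
  covered phi N -> covered (Exists p phi) N.
Proof.
move=> [I [P [cardI cP satP]]].
exists I, (fun i T =>
  exists F, (forall s, s \in T -> F s != fset0) /\ P i (update T p F)).
split=> // [i T1 T2 T [F1 [F1n0 P1]] [F2 [F2n0 P2]]
  /fsubsetP s1 /fsubsetP s2|T FVT].
  pose S := update T1 p F1 `|` update T2 p F2.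
  (* Taking every bit that lands in [S] keeps the update of [T] inside [S], and it contains the
     update of [T1] because [T1] lies in [T]. *)
  pose F s := [fset a in [:: false; true] | s.[p <- a] \in S].
  have inF s a : (a \in F s) = (s.[p <- a] \in S) by rewrite !inE; case: a.
  exists F; split=> [s /s2|].
    rewrite inE => /orP[Ts|Ts]; apply/fset0Pn.
      have /fset0Pn[a Fa] := F1n0 s Ts; exists a; rewrite inF inE.
      by apply/orP; left; apply/updateP; exists s, a.
    have /fset0Pn[a Fa] := F2n0 s Ts; exists a; rewrite inF inE.
    by apply/orP; right; apply/updateP; exists s, a.
  apply: (cP i _ _ _ P1 P2); apply/fsubsetP=> u.
    move=> Su; have /updateP[s [a [Ts Fa eu]]] := Su; apply/updateP.
    by exists s, a; split=> //; [apply: s1|rewrite inF -eu inE Su].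
  by case/updateP=> s [a [_]]; rewrite inF => ? ->.
split=> [[F [Fn0 satF]]|[i [F [Fn0 Pi]]]].
  have [i Pi] := iffLR (satP _ (on_FV_update FVT)) satF.
  by exists i, F.
exists F; split=> //; apply/satP; last by exists i.
exact: on_FV_update.
Qed.

(** Updating by all bits is monotone and commutes with unions. *)
Lemma covered_Forall (at_ : atom_kind) (p : nat) (phi : formula at_) (N : nat) :
  covered phi N -> covered (Forall p phi) N.
Proof.
move=> [I [P [cardI cP satP]]].
pose all_bits (s : evaluation) := [fset false; true].
exists I, (fun i T => P i (update T p all_bits)).
split=> // [i T1 T2 T P1 P2 /fsubsetP s1 /fsubsetP s2|T FVT]; last first.
  exact: satP (on_FV_update FVT).
apply: (cP i _ _ _ P1 P2); apply/fsubsetP=> u /updateP[s [a [Ts Fa ->]]].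
  by apply/updateP; exists s, a; split=> //; apply: s1.
by move: (s2 _ Ts); rewrite !inE => /orP[] Ts'; apply/orP; [left|right];
  apply/updateP; exists s, a.
Qed.

(** Positivity allows the number of atoms in an exponent to be replaced by an upper bound. *)
Lemma dim_gt0 (at_ : atom_kind) (k : nat) : 0 < k -> 0 < dim at_ k.
Proof.
move=> k_gt0; rewrite /dim; case: at_; rewrite subn_gt0.
  by rewrite ltn_exp2l // ltn_expl.
by rewrite -[2 in X in X < _](expn1 2) ltn_exp2l // -[1]/(2 ^ 0) ltn_exp2l.
Qed.

Lemma covered_arities (at_ : atom_kind) (k : nat) (phi : formula at_) :
  0 < k -> (forall i, i \in arities phi -> i <= k) ->
  covered phi (dim at_ k ^ size (arities phi)).
Proof.
move=> k_gt0.
elim: phi => [p|p|i ps qs|phi IHphi psi IHpsi|phi IHphi psi IHpsi|p phi IH|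
  p phi IH] /= ar.
- exact: (covered_literal at_ p true).
- exact: (covered_literal at_ p false).
- by rewrite expn1; apply: covered_atom => //; apply: ar; rewrite inE.
- rewrite size_cat expnD; apply: covered_And; [apply: IHphi|apply: IHpsi];
    by move=> i ar_i; apply: ar; rewrite mem_cat ar_i ?orbT.
- rewrite size_cat expnD; apply: covered_Or; [apply: IHphi|apply: IHpsi];
    by move=> i ar_i; apply: ar; rewrite mem_cat ar_i ?orbT.
- exact/covered_Exists/IH.
- exact/covered_Forall/IH.
Qed.

Lemma covered_QPL (at_ : atom_kind) (k m : nat) (phi : formula at_) :
  0 < k -> QPL k m phi -> covered phi (dim at_ k ^ m).
Proof.
move=> k_gt0 [size_ar ar]; apply: covered_sub (covered_arities k_gt0 ar).
by rewrite leq_pexp2l // dim_gt0.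
Qed.

(** * Teams over disjoint blocks of symbols *)

(** A triple gives the atom, its side ([true] for left) and the position in the word. *)
Definition symbol (n K : nat) (x : 'I_n * bool * 'I_K) : nat := choice.pickle x.

Definition block (n K : nat) (i : 'I_n) (b : bool) : K.-tuple nat :=
  [tuple symbol (i, b, j) | j < K].

Definition symbols (n K : nat) : {fset nat} :=
  [fset v in codom (@symbol n K)].

(** The default [false] is never reached: all symbols of the domain decode. *)
Definition valuation (n K : nat)
    (h : {ffun 'I_n * bool -> {ffun 'I_K -> bool}}) : evaluation :=
  [fmap v : symbols n K =>
     oapp (fun x : 'I_n * bool * 'I_K => h x.1 x.2) false (choice.unpickle (val v))].

Lemma symbol_in (n K : nat) (x : 'I_n * bool * 'I_K) :
  symbol x \in symbols n K.
Proof. by rewrite !inE codom_f. Qed.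

Lemma values_valuation (n K : nat) (i : 'I_n) (b : bool)
    (h : {ffun 'I_n * bool -> {ffun 'I_K -> bool}}) :
  values (valuation h) (block K i b) = [seq Some (h (i, b) j) | j <- enum 'I_K].
Proof.
rewrite /values -map_comp; apply: eq_map => j /=.
have Vx := symbol_in (i, b, j).
by rewrite (in_fnd (f := valuation h) Vx) ffunE /= choice.pickleK.
Qed.

Lemma values_valuation_inj (n K : nat) (i i' : 'I_n) (b b' : bool)
    (h h' : {ffun 'I_n * bool -> {ffun 'I_K -> bool}}) :
  values (valuation h) (block K i b) = values (valuation h') (block K i' b')
  <-> h (i, b) = h' (i', b').
Proof.
rewrite !values_valuation; split=> [/eq_in_map eq_h|-> //].
by apply/ffunP=> j; have [] := eq_h j (mem_enum _ j).
Qed.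

Definition team (n K : nat)
    (H : {set {ffun 'I_n * bool -> {ffun 'I_K -> bool}}}) : {fset evaluation} :=
  [fset valuation h | h in H].

Lemma team_over_symbols (n K : nat)
    (H : {set {ffun 'I_n * bool -> {ffun 'I_K -> bool}}}) :
  team_over (symbols n K) (team H).
Proof. by move=> s /imfsetP[h _ ->]. Qed.

Lemma team_subset (n K : nat)
    (H H' : {set {ffun 'I_n * bool -> {ffun 'I_K -> bool}}}) :
  H \subset H' -> team H `<=` team H'.
Proof.
move=> /subsetP sH; apply/fsubsetP=> s /imfsetP[h /= Hh ->].
by apply/imfsetP; exists h => //=; apply: sH.
Qed.

Lemma team_setU (n K : nat)
    (H H' : {set {ffun 'I_n * bool -> {ffun 'I_K -> bool}}}) :
  team (H :|: H') `<=` team H `|` team H'.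
Proof.
apply/fsubsetP=> s /imfsetP[h /=]; rewrite !inE => /orP[Hh|Hh] ->.
  by apply/orP; left; apply: in_imfset.
by apply/orP; right; apply: in_imfset.
Qed.

Lemma sat_block_atom (at_ : atom_kind) (n K : nat) (i : 'I_n)
    (H : {set {ffun 'I_n * bool -> {ffun 'I_K -> bool}}}) :
  sat (team H) (Atom at_ (block K i true) (block K i false)) <->
  atomic at_ (fun h => h \in H) (fun h => h (i, true)) (fun h => h (i, false)).
Proof.
case: at_ => /=; split.
- move=> incl h Hh; have [|s] := incl (valuation h); first exact: in_imfset.
  by case/imfsetP=> h' /= Hh' -> /values_valuation_inj; exists h'.
- move=> incl s /imfsetP[h /= Hh ->]; have [h' Hh' eq_h] := incl h Hh.
  by exists (valuation h'); [apply: in_imfset|apply/values_valuation_inj].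
- move=> excl h h' Hh Hh' eq_h.
  apply: (excl (valuation h) (valuation h')); try exact: in_imfset.
  exact/values_valuation_inj.
- move=> excl s s' /imfsetP[h /= Hh ->] /imfsetP[h' /= Hh' ->].
  by move/values_valuation_inj; apply: excl.
Qed.

(** * Conjunctions of disjoint atoms *)

(** The fold starts from [f x] because the syntax has no constant for truth. *)
Definition And_seq (at_ : atom_kind) (X : Type) (f : X -> formula at_) (x : X)
    (l : seq X) : formula at_ :=
  foldr (fun y phi => And (f y) phi) (f x) l.

Lemma sat_And_seq (at_ : atom_kind) (X : eqType) (f : X -> formula at_) (x : X)
    (l : seq X) (T : {fset evaluation}) :
  sat T (And_seq f x l) <-> (forall y, y \in x :: l -> sat T (f y)).
Proof.
elim: l => /= [|z l IH].
  by split=> [satx y|]; [rewrite inE => /eqP->|apply; rewrite inE].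
split=> [[satz /IH satl] y|satl].
  by rewrite !inE orbCA => /orP[/eqP->//|xl]; apply: satl; rewrite inE.
split; first by apply: satl; rewrite !inE eqxx orbT.
apply/IH=> y; rewrite inE => /orP[yx|yl]; apply: satl;
by rewrite !inE ?yx ?yl ?orbT.
Qed.

Lemma FV_And_seq (at_ : atom_kind) (X : Type) (f : X -> formula at_) (x : X)
    (l : seq X) (V : {fset nat}) :
  (forall y, FV (f y) `<=` V) -> FV (And_seq f x l) `<=` V.
Proof. by move=> FVf; elim: l => //= z l IH; rewrite fsubUset FVf. Qed.

Lemma arities_And_seq (at_ : atom_kind) (X : Type) (f : X -> formula at_)
    (x : X) (l : seq X) (k : nat) :
  (forall y, arities (f y) = [:: k]) ->
  arities (And_seq f x l) = nseq (size l).+1 k.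
Proof. by move=> arf; elim: l => //= z l ->; rewrite arf. Qed.

(** The fold starts at [ord0], and [behead] drops it from the list, so each of the [n.+1] atoms
    occurs once. *)
Definition disjoint_atoms (at_ : atom_kind) (n K : nat) : formula at_ :=
  And_seq (fun i : 'I_n.+1 => Atom at_ (block K i true) (block K i false))
    ord0 (behead (enum 'I_n.+1)).

Lemma QPL_disjoint_atoms (at_ : atom_kind) (n K : nat) :
  QPL K n.+1 (disjoint_atoms at_ n K).
Proof.
rewrite /QPL (@arities_And_seq _ _ _ _ _ K) // size_behead size_enum_ord.
by rewrite size_nseq; split=> // i /nseqP[->].
Qed.

Lemma FV_disjoint_atoms (at_ : atom_kind) (n K : nat) :
  FV (disjoint_atoms at_ n K) `<=` symbols n.+1 K.
Proof.
apply: FV_And_seq => i; apply/fsubsetP=> v /=.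
by rewrite !inE => /orP[] /mapP[j _ ->]; apply: codom_f.
Qed.

Lemma sat_disjoint_atoms (at_ : atom_kind) (n K : nat)
    (H : {set {ffun 'I_n.+1 * bool -> {ffun 'I_K -> bool}}}) :
  sat (team H) (disjoint_atoms at_ n K) <->
  (forall i, atomic at_ (fun h => h \in H)
               (fun h => h (i, true)) (fun h => h (i, false))).
Proof.
apply: iff_trans (sat_And_seq _ _ _ _) _; split=> satH i; last first.
  by move=> _; apply/sat_block_atom.
apply/sat_block_atom/satH; have := mem_enum 'I_n.+1 i.
by rewrite enum_ordSl /= inE => ->.
Qed.

(** * Boxes and their separation *)

(* Box number [A] consists of the pairs with left and right entries in
   [side A true] and [side A false]. For inclusion, [A = set0] stands for the
   single diagonal pair at [a0]: with the empty box a product would collapse. *)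
Definition side (at_ : atom_kind) (U : finType) (a0 : U) (A : {set U})
    (b : bool) : {set U} :=
  match at_ with
  | Inclusion => if A == set0 then [set a0] else A
  | Exclusion => if b then A else ~: A
  end.

Lemma side_neq0 (at_ : atom_kind) (U : finType) (a0 : U) (A : {set U})
    (b : bool) :
  A \in index_set at_ U -> exists x, x \in side at_ a0 A b.
Proof.
case: at_ => /=; rewrite inE.
  move=> _; case: eqP => [_|/eqP/set0Pn //]; by exists a0; rewrite inE.
case/andP=> A0 AT; case: b; first exact/set0Pn.
by apply/set0Pn; apply: contra AT => /eqP AC0; rewrite -[A]setCK AC0 setC0.
Qed.

(* A pair [(x, y)] of box [B] that violates the atom when added to box [A]. *)
Definition separated (at_ : atom_kind) (U : finType) (a0 : U)
    (A B : {set U}) : Prop :=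
  exists x y, [/\ x \in side at_ a0 B true, y \in side at_ a0 B false &
    match at_ with
    | Inclusion => (x \notin side at_ a0 A false) && (x != y)
    | Exclusion => x \in side at_ a0 A false
    end].

(** Take [x] in [B] outside the box of [A]; a second element [y] of [B] keeps the added pair from
    being its own witness. *)
Lemma separated_subset (U : finType) (a0 : U) (A B : {set U}) :
  1 < #|B| -> ~~ (B \subset side Inclusion a0 A true) ->
  separated Inclusion a0 A B.
Proof.
move=> B_gt1 /subsetPn[x Bx xA].
have B0 : (B == set0) = false by apply: contraTF B_gt1 => /eqP->; rewrite cards0.
have /card_gt0P[y] : 0 < #|B :\ x| by move: B_gt1; rewrite (cardsD1 x) Bx.
rewrite !inE eq_sym => /andP[xy By].
by exists x, y; rewrite /= B0; split=> //; apply/andP.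
Qed.

(** One of two distinct sets has a point outside the other. For inclusion, nonempty indices have two
    elements, so none fits into the box of [set0]. *)
Lemma index_separated (at_ : atom_kind) (U : finType) (a0 : U)
    (A B : {set U}) :
  A \in index_set at_ U -> B \in index_set at_ U -> A <> B ->
  separated at_ a0 A B \/ separated at_ a0 B A.
Proof.
move=> IA IB AB.
have : ~~ (A \subset B) || ~~ (B \subset A).
  by rewrite -negb_and -eqEsubset; apply/eqP.
case: at_ IA IB => IA IB; last first.
  case/orP=> /subsetPn[x xA xB]; [right|left].
    have [y] := side_neq0 a0 false IA; rewrite inE => yA.
    by exists x, y; split; rewrite /= ?in_setC.
  have [y] := side_neq0 a0 false IB; rewrite inE => yB.
  by exists x, y; split; rewrite /= ?in_setC.
have gt1 (C : {set U}) : C \in index_set Inclusion U -> C != set0 -> 1 < #|C|.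
  by rewrite inE -card_gt0; case: #|C| => [|[]].
have sub1 (C : {set U}) : 1 < #|C| -> ~~ (C \subset [set a0]).
  by apply: contraL => /subset_leq_card; rewrite cards1 -leqNgt.
have [A0|A0] := eqVneq A set0.
  have B_gt1 : 1 < #|B|.
    by apply: gt1 => //; apply/eqP=> B0; apply: AB; rewrite A0.
  by move=> _; left; apply: separated_subset; rewrite //= A0 eqxx sub1.
have [B0|B0] := eqVneq B set0.
  by move=> _; right; apply: separated_subset; rewrite ?gt1 //= B0 eqxx sub1 ?gt1.
case/orP=> nsub; [right|left]; apply: separated_subset; rewrite ?gt1 //=.
  by rewrite (negPf B0).
by rewrite (negPf A0).
Qed.

Definition box (at_ : atom_kind) (I U : finType) (a0 : U) (A : I -> {set U}) :
    {set {ffun I * bool -> U}} :=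
  [set h : {ffun I * bool -> U} |
    [forall ib, h ib \in side at_ a0 (A ib.1) ib.2]].

(** All sides are nonempty, so the remaining coordinates can be filled arbitrarily. *)
Lemma box_extend (at_ : atom_kind) (I U : finType) (a0 : U)
    (A : I -> {set U}) (i : I) (x y : U) :
  (forall j, A j \in index_set at_ U) ->
  x \in side at_ a0 (A i) true -> y \in side at_ a0 (A i) false ->
  exists h, [/\ h \in box at_ a0 A, h (i, true) = x & h (i, false) = y].
Proof.
move=> IA Ax Ay.
have [h0 Ah0] :=
  fin_all_exists (fun ib : I * bool => side_neq0 a0 ib.2 (IA ib.1)).
exists [ffun ib => if ib.1 == i then if ib.2 then x else y else h0 ib].
rewrite !ffunE /= eqxx; split=> //; rewrite inE; apply/forallP=> -[j b].
by rewrite ffunE /=; case: eqP => [->|_]; [case: b|apply: (Ah0 (j, b))].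
Qed.

Lemma atomic_box (at_ : atom_kind) (I U : finType) (a0 : U)
    (A : I -> {set U}) (i : I) :
  (forall j, A j \in index_set at_ U) ->
  atomic at_ (fun h => h \in box at_ a0 A)
    (fun h => h (i, true)) (fun h => h (i, false)).
Proof.
move=> IA.
have inbox h b : h \in box at_ a0 A -> h (i, b) \in side at_ a0 (A i) b.
  by rewrite inE => /forallP/(_ (i, b)).
case: at_ IA inbox => IA inbox /=.
  move=> h /(inbox _ true) Ah.
  (* For inclusion both sides of a box coincide, so the left entry may also be used on the right. *)
  by have [h' [Ah' _ eq_h]] := box_extend IA Ah Ah; exists h'.
move=> h h' /(inbox _ true) /= Ah /(inbox _ false) /=.
by rewrite inE => Ah' eq_h; rewrite -eq_h Ah in Ah'.
Qed.

(** One point of box [B] with the separating pair at [i] is added to box [A]. For inclusion its left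
    entry has no witness; for exclusion that entry is a right entry in box [A]. *)
Lemma separated_box (at_ : atom_kind) (I U : finType) (a0 : U)
    (A B : I -> {set U}) (i : I) :
  (forall j, A j \in index_set at_ U) -> (forall j, B j \in index_set at_ U) ->
  separated at_ a0 (A i) (B i) ->
  exists H : {set {ffun I * bool -> U}},
    [/\ box at_ a0 A \subset H, H \subset box at_ a0 A :|: box at_ a0 B &
        ~ atomic at_ (fun h => h \in H)
            (fun h => h (i, true)) (fun h => h (i, false))].
Proof.
move=> IA IB [x [y [Bx By sep]]].
have [h [Bh hx hy]] := box_extend IB Bx By.
exists (h |: box at_ a0 A); split; first exact: subsetUr.
  by rewrite subUset subsetUl andbT sub1set inE Bh orbT.
case: at_ {Bx By Bh} IA IB sep => IA _ /=.
  move=> /andP[Ax xy] /(_ h (setU11 _ _)) [h']; rewrite !inE hx.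
  case/orP=> [/eqP->|/forallP/(_ (i, false)) /= Ah'] eq_x.
    by rewrite eq_x hy eqxx in xy.
  by rewrite eq_x Ah' in Ax.
move=> Ax excl; have [z Az] := side_neq0 a0 true (IA i).
have [h' [Ah' _ h'x]] := box_extend IA Az Ax.
by apply: (excl h h'); rewrite ?setU11 ?hx ?h'x // setU1r.
Qed.

(** * Lower bound for disjoint atoms *)

Lemma disjoint_atoms_lower_bound (at_ : atom_kind) (n K N : nat)
    (psi : formula at_) :
  0 < K -> covered psi N -> equivalent (disjoint_atoms at_ n K) psi ->
  dim at_ K ^ n.+1 <= N.
Proof.
move=> K_gt0 [I [P [cardI cP satP]]] [FVeq sat_eq].
apply: leq_trans cardI; pose phi := disjoint_atoms at_ n K.
pose U : finType := {ffun 'I_K -> bool}; pose a0 : U := [ffun=> true].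
pose J : finType := {A : {set U} | A \in index_set at_ U}.
have cardJ : #|{ffun 'I_n.+1 -> J}| = dim at_ K ^ n.+1.
  rewrite card_ffun card_ord card_sig; congr (_ ^ _); apply: card_index_set => //.
  by rewrite card_ffun card_bool card_ord.
rewrite -cardJ.
have satPt (H : {set {ffun 'I_n.+1 * bool -> U}}) : sat (team H) phi <-> exists i, P i (team H).
  apply: iff_trans (sat_eq _ _ (team_over_symbols (H := H)) _) (satP _ _).
    exact: FV_disjoint_atoms.
  by move=> s /team_over_symbols->; rewrite -FVeq FV_disjoint_atoms.
pose T (A : {ffun 'I_n.+1 -> J}) := box at_ a0 (fun i => val (A i)).
have idx (A : {ffun 'I_n.+1 -> J}) i : val (A i) \in index_set at_ U.
  exact: valP.
have satT A : exists i, P i (team (T A)).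
  by apply/satPt/sat_disjoint_atoms=> i; apply: atomic_box.
have [c Pc] := fin_all_exists satT.
(* With a common index, the separating team would lie in that family and satisfy [phi], although
   atom [i] fails in it. *)
have nsep A B i : c A = c B -> ~ separated at_ a0 (val (A i)) (val (B i)).
  move=> eq_c /(separated_box (idx A) (idx B))[H [sTH sHT []]].
  suff /sat_disjoint_atoms : sat (team H) phi by apply.
  apply/satPt; exists (c A); apply: (cP _ (team (T A)) (team (T B))) => //.
  - by rewrite eq_c.
  - exact: team_subset.
  - exact: fsubset_trans (team_subset sHT) (team_setU _ _).
apply: (@leq_card _ _ c) => A B eq_c; apply/ffunP=> i; apply/val_inj/eqP.
apply/negP=> /negP/eqP /(index_separated a0 (idx A i) (idx B i)) [].
  exact: nsep.
by apply: nsep.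
Qed.

(** * Separating the logics *)

Lemma not_le_logic_QPL (at_ : atom_kind) (k K n m : nat) :
  0 < k -> 0 < K -> 0 < n -> dim at_ k ^ m < dim at_ K ^ n ->
  ~ le_logic (@QPL at_ K n) (@QPL at_ k m).
Proof.
move=> k_gt0 K_gt0; case: n => // n _ lt_dim /(_ _ (QPL_disjoint_atoms at_ n K)).
case=> psi /(covered_QPL k_gt0) cov /(disjoint_atoms_lower_bound K_gt0 cov).
by rewrite leqNgt lt_dim.
Qed.

(** With [a = 2 ^ k] and [N = 2 ^ a], the claim is [(N - a) ^ 2 < N ^ 2 - 2 * a] or
    [(N - 2) ^ 2 < N ^ 2 - 2]; both follow from [2 * a < N] and [4 <= a]. *)
Lemma dim_sqr_lt (at_ : atom_kind) (k : nat) :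
  2 <= k -> dim at_ k ^ 2 < dim at_ k.+1.
Proof.
move=> k_ge2; rewrite /dim !expnS muln1.
have lt_Sk : k.+1 < 2 ^ k.
  by elim: k k_ge2 => [|[|[|k]] IH] // _; rewrite expnS; have := IH isT; lia.
have : 2 * 2 ^ k < 2 ^ 2 ^ k by rewrite -expnS ltn_exp2l.
have : 4 <= 2 ^ k by rewrite -[4]/(2 ^ 2) leq_exp2l.
rewrite [2 * 2 ^ k]mul2n -addnn expnD.
by case: at_; move: (2 ^ k) (2 ^ _) => a N; nia.
Qed.

Theorem theorem5p4 (at_ : atom_kind) :
  (forall n m : nat, 0 < n -> n <= m -> m <= 3 * n ->
     ~ le_logic (@QPL at_ 2 n) (@QPL at_ 1 m)) /\
  (forall k n m : nat, 2 <= k -> 0 < n -> n <= m -> m <= 2 * n ->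
     ~ le_logic (@QPL at_ k.+1 n) (@QPL at_ k m)).
Proof.
split=> [n m n_gt0 _ le_m|k n m k_ge2 n_gt0 _ le_m].
  apply: not_le_logic_QPL => //.
  apply: (@leq_ltn_trans (dim at_ 1 ^ (3 * n))).
    by rewrite leq_pexp2l // dim_gt0.
  (* Both kinds have dimension 2 at arity 1, and its cube 8 is below the dimensions 12 and 14 at
     arity 2. *)
  by rewrite expnM ltn_exp2r //; case: at_.
have k_gt0 : 0 < k by apply: leq_trans k_ge2.
apply: not_le_logic_QPL => //.
apply: (@leq_ltn_trans (dim at_ k ^ (2 * n))).
  by rewrite leq_pexp2l // dim_gt0.
by rewrite expnM ltn_exp2r // dim_sqr_lt.
Qed.
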